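(* Let $T,S\in \mathbb{B}_{A^{1/2}}(\mathcal{H})$. Then for any given $\varepsilon\in[0,1)$, the following conditions are equivalent: (i) $T\perp^B_{A,\varepsilon} S$, i.e. $\|T+\lambda S\|_A^2\ge \|T\|_A^2-2\varepsilon\|T\|_A\|\lambda S\|_A$ for all $\lambda\in\mathbb{C}$; (ii) $W_A(T,S)\cap B(0,\varepsilon\|T\|_A\|S\|_A)\neq\emptyset$, where $B(0,r)$ denotes the closed disc in $\mathbb{C}$ of radius $r$ centred at $0$.
   Context: $\mathcal{H}$ is a complex Hilbert space with inner product $\langle\cdot,\cdot\rangle$, $\mathbb{B}(\mathcal{H})$ is the algebra of bounded linear operators on $\mathcal{H}$, and $A\in\mathbb{B}(\mathcal{H})$ is a fixed non-zero positive operator ($\langle Ax,x\rangle\ge 0$ for all $x$; $A$ need not be injective). Put $\langle x,y\rangle_A=\langle Ax,y\rangle$, $\|x\|_A=\sqrt{\langle x,x\rangle_A}$ and $\mathbb{S}_{\mathcal{H}}^A=\{x\in\mathcal{H}:\|x\|_A=1\}$. $\mathbb{B}_{A^{1/2}}(\mathcal{H})$ is the set of $T\in\mathbb{B}(\mathcal{H})$ for which there is $c>0$ with $\|Tx\|_A\le c\|x\|_A$ for all $x\in\mathcal{H}$; for such $T$, $\|T\|_A=\sup\{\|Tx\|_A: x\in\mathbb{S}_{\mathcal{H}}^A\}<\infty$. For $T,S\in\mathbb{B}_{A^{1/2}}(\mathcal{H})$, $W_A(T,S)$ is the set of all $\lambda\in\mathbb{C}$ for which there exists a sequence $\{x_n\}\subseteq\mathbb{S}_{\mathcal{H}}^A$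 with $\|Tx_n\|_A\to\|T\|_A$ and $\langle Sx_n,Tx_n\rangle_A\to\lambda$. *)

(* Defs.v *)
From HB Require Import structures.
From mathcomp Require Import all_boot all_order all_algebra sesquilinear.
From mathcomp Require Import complex.
From mathcomp Require Import all_classical all_reals all_analysis.

Set Implicit Arguments.
Unset Strict Implicit.
Unset Printing Implicit Defensive.

Import Order.TTheory GRing.Theory Num.Theory.
Import numFieldNormedType.Exports.

Local Open Scope classical_set_scope.
Local Open Scope ring_scope.
Local Open Scope complex_scope.

(* A complex Hilbert space is a complete normed module [H] over [R[i]] together
   with a positive definite form [ip : {dot H for Num.conj}] (linear in its first
   argument, conjugate-linear in the second) whose diagonal is the squared norm;
   [norm_ip] is that compatibility condition. *)
Definition norm_ip (R : realType) (H : completeNormedModType R[i])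
    (ip : {dot H for Num.conj}) : Prop :=
  forall x : H, `|x| ^+ 2 = ip x x.

Definition bounded_op (R : realType) (H : completeNormedModType R[i])
    (T : H -> H) : Prop :=
  exists M : R, forall x : H, `|T x| <= M%:C * `|x|.

Lemma bounded_opP (R : realType) (H : completeNormedModType R[i])
    (T : {linear H -> H}) : bounded_op T <-> continuous T.
Proof.
rewrite -(linear_bounded_continuous T); split.
  move=> [M TM]; apply/linear_boundedP.
  exists M%:C; split => [|c Mc x]; first by rewrite complex_real.
  by rewrite (le_trans (TM x))// ler_wpM2r// ltW.
move=> /linear_boundedP/pinfty_ex_gt0 [c c0 Tc]; exists (complex.Re c) => x.
by rewrite RRe_real ?gtr0_real.
Qed.

(* The order of [R[i]] makes [0 <= z] mean that [z] is real and nonnegative. *)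
Definition positive_op (R : realType) (H : completeNormedModType R[i])
    (ip : {dot H for Num.conj}) (A : H -> H) : Prop :=
  forall x : H, 0 <= ip (A x) x.

Section SemiHilbert.
Context (R : realType) (H : completeNormedModType R[i]).
Variables (ip : {dot H for Num.conj}) (A : {linear H -> H}).
Implicit Types (T S : H -> H) (x y : H).

Definition ipA x y : R[i] := ip (A x) y.

(* For positive [A], [ipA x x] is real, so taking its real part loses nothing. *)
Definition normA x : R := Num.sqrt (complex.Re (ipA x x)).

Definition sphereA : set H := [set x | normA x = 1].

Definition bounded_opA T : Prop :=
  bounded_op T /\
  exists2 c : R, 0 < c & forall x, normA (T x) <= c * normA x.

Definition opnormA T : R := sup [set normA (T x) | x in sphereA].

(* [R[i]] is not canonically a topological space; its norm topology is carried by
   the alias [R[i]^o]. *)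
Definition maxrangeA T S : set R[i] := [set lambda |
  exists x_ : nat -> H,
    [/\ forall n, sphereA (x_ n),
        normA (T (x_ n)) @[n --> \oo] --> opnormA T
      & (ipA (S (x_ n)) (T (x_ n)) : R[i]^o) @[n --> \oo] --> (lambda : R[i]^o)]].

Definition approx_orthoA (eps : R) T S : Prop :=
  forall lambda : R[i],
    opnormA T ^+ 2 - 2 * eps * opnormA T * opnormA (lambda \*: S) <=
    opnormA (T \+ lambda \*: S) ^+ 2.

End SemiHilbert.

Definition cdisc (R : realType) (r : R) : set R[i] := [set z | `|z| <= r%:C].

(* Main.v *)
(* (ii) => (i): expand |(T + c S) x_n|_A^2 along a sequence realizing a point of
   the maximal range and let n tend to infinity.

   (i) => (ii): let r = eps |T|_A |S|_A, f x = <S x, T x>_A and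
   h x = |T|_A^2 |x|_A^2 - |T x|_A^2, a positive semidefinite form.  Orthogonality
   applied to c = - t u with t small and |u| = 1 gives A-unit vectors y with h y
   small and Re (u f y) <= r + small.  If some A-unit x with h x small has
   |f x| > r, take u with u f x = |f x|: adding to x a small multiple of y, of
   suitable phase, decreases |f| by a definite amount and keeps h small.  Hence
   |f| gets arbitrarily close to r, or below it, on A-unit vectors with h
   arbitrarily small, and Bolzano-Weierstrass yields the required limit point.
   This replaces the convexity of the maximal range by a local form of the
   Toeplitz-Hausdorff argument. *)
Require Import Defs.
From HB Require Import structures.
From mathcomp Require Import all_boot all_order all_algebra sesquilinear.
From mathcomp Require Import complex.
From mathcomp Require Import all_classical all_reals all_analysis.
From mathcomp Require Import ring lra.

Set Implicit Arguments.
Unset Strict Implicit.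
Unset Printing Implicit Defensive.

Import Order.TTheory GRing.Theory Num.Theory.
Import numFieldNormedType.Exports.
Import ComplexField.Normc.

Local Open Scope classical_set_scope.
Local Open Scope ring_scope.
Local Open Scope complex_scope.

(** * Modulus and phase of complex numbers *)

Section ComplexModulus.
Context (R : realType).
Implicit Types z w : R[i].

Lemma normc_ge0 z : 0 <= normc z.
Proof. by case: z => a b; exact: sqrtr_ge0. Qed.

Lemma sqr_normcE z : normc z ^+ 2 = complex.Re z ^+ 2 + complex.Im z ^+ 2.
Proof. by case: z => a b /=; rewrite sqr_sqrtr// addr_ge0 ?sqr_ge0. Qed.

Lemma mulc_conj z : z * conjc z = (normc z ^+ 2)%:C.
Proof.
by rewrite sqr_normcE; case: z => a b; rewrite /real_complex_def; simpc;
  congr (_ +i* _); rewrite -?expr2//; ring.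
Qed.

Lemma normc_conj z : normc (conjc z) = normc z.
Proof. by case: z => a b /=; rewrite sqrrN. Qed.

Lemma normc_real (a : R) : normc a%:C = `|a|.
Proof. by rewrite /= expr0n addr0 sqrtr_sqr. Qed.

Lemma normr_Re_le z : `|complex.Re z| <= normc z.
Proof.
case: z => a b /=; rewrite -sqrtr_sqr; apply: ler_wsqrtr.
by rewrite lerDl sqr_ge0.
Qed.

Lemma normr_Im_le z : `|complex.Im z| <= normc z.
Proof.
case: z => a b /=; rewrite -sqrtr_sqr; apply: ler_wsqrtr.
by rewrite lerDr sqr_ge0.
Qed.

Lemma normc_le_ReIm z : normc z <= `|complex.Re z| + `|complex.Im z|.
Proof.
rewrite -ler_sqr ?nnegrE ?addr_ge0 ?normc_ge0// sqr_normcE sqrrD !real_normK ?num_real//.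
by rewrite -addrA lerD2l lerDr mulrn_wge0 ?mulr_ge0.
Qed.

Lemma unimodular_mul z : exists2 u : R[i], normc u = 1 & u * z = (normc z)%:C.
Proof.
have [->|z0] := eqVneq z 0.
  by exists 1; rewrite ?normc1// mulr0 normc0.
have nz0 : normc z != 0 by apply: contra z0 => /eqP/eq0_normc ->.
exists ((normc z)^-1%:C * conjc z).
  by rewrite normcM normc_conj normc_real ger0_norm ?invr_ge0 ?normc_ge0// mulVf.
by rewrite -mulrA [conjc z * z]mulrC mulc_conj -rmorphM/= expr2 mulKf.
Qed.

(** If [v] rotates [w - conjc z] onto the nonnegative reals, then [conjc v * z + v * w] is the
    modulus of [w - conjc z] plus [2 Re (conjc v * z)], hence real; passing to [- v] corrects the
    sign if needed. *)
Lemma unimodular_combination_le0 z w : exists u : R[i], exists k : R,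
  [/\ normc u = 1, 0 <= k & conjc u * z + u * w = (- k)%:C].
Proof.
have [v v1 vE] := unimodular_mul (w - conjc z).
have rE : conjc v * z + v * w = (normc (w - conjc z) + 2 * complex.Re (conjc v * z))%:C.
  rewrite rmorphD/= -vE rmorphM/= rmorph_nat -addcJ rmorphM/= conjcK.
  by ring.
have [r0|r0] := leP (normc (w - conjc z) + 2 * complex.Re (conjc v * z)) 0.
  by exists v, (- (normc (w - conjc z) + 2 * complex.Re (conjc v * z)));
    split; rewrite ?oppr_ge0// opprK.
exists (- v), (normc (w - conjc z) + 2 * complex.Re (conjc v * z)); split.
- by rewrite normcN.
- exact: ltW.
- by rewrite rmorphN/= !mulNr -opprD rE rmorphN.
Qed.

End ComplexModulus.

(** * Sesquilinear forms: expansion, parallelogram law, Cauchy-Schwarz *)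

Section SesquilinearForm.
Context (R : realType) (V : lmodType R[i]).
Implicit Types (F : V -> V -> R[i]) (x y : V) (c : R[i]).

(** A predicate on bare functions, so that it also covers non-Hermitian forms such as
    [E (S x) (T y)]. *)
Definition sesqui_form F : Prop :=
  [/\ forall x y z, F (x + y) z = F x z + F y z,
      forall x y z, F z (x + y) = F z x + F z y,
      forall c x y, F (c *: x) y = c * F x y
    & forall c x y, F x (c *: y) = conjc c * F x y].

Definition diag F x : R := complex.Re (F x x).

Lemma sesqui_formZ F c x : sesqui_form F ->
  F (c *: x) (c *: x) = (normc c ^+ 2)%:C * F x x.
Proof. by case=> _ _ Zl Zr; rewrite Zl Zr mulrA mulc_conj. Qed.

Lemma sesqui_formDZ F c x y : sesqui_form F ->
  F (x + c *: y) (x + c *: y) =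
  F x x + (conjc c * F x y + c * F y x) + (normc c ^+ 2)%:C * F y y.
Proof.
move=> sF; rewrite -(sesqui_formZ _ _ sF).
by case: sF => Dl Dr Zl Zr; rewrite Dl !Dr !Zl !Zr; ring.
Qed.

Lemma diagZ F c x : sesqui_form F -> diag F (c *: x) = normc c ^+ 2 * diag F x.
Proof.
by move=> sF; rewrite /diag sesqui_formZ//; case: (F x x) => a b /=; rewrite mul0r subr0.
Qed.

Lemma diag_parallelogram F x y : sesqui_form F ->
  diag F (x + y) + diag F (x - y) = 2 * diag F x + 2 * diag F y.
Proof.
move=> sF; have := sesqui_formDZ 1 x y sF; have := sesqui_formDZ (-1) x y sF.
rewrite /diag scale1r scaleN1r => -> ->; rewrite normcN normc1 expr1n.
rewrite rmorphN rmorph1 !mulN1r !mul1r.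
by case: (F x x) (F x y) (F y x) (F y y) => [a ?] [b ?] [c ?] [d ?]/=; ring.
Qed.

Lemma diagD_le F x y : sesqui_form F -> (forall z, 0 <= diag F z) ->
  diag F (x + y) <= 2 * diag F x + 2 * diag F y.
Proof. by move=> sF F0; rewrite -diag_parallelogram// lerDl. Qed.

Lemma diag_le_addr F x y : sesqui_form F -> (forall z, 0 <= diag F z) ->
  diag F x <= 2 * diag F (x + y) + 2 * diag F y.
Proof.
move=> sF F0; have := diagD_le (x + y) (- y) sF F0; rewrite addrK.
by rewrite -scaleN1r diagZ// normcN normc1 expr1n mul1r.
Qed.

(* Polarization: only the diagonal being real is used. *)
Lemma sesqui_form_hermitian F x y : sesqui_form F ->
  (forall z, 0 <= F z z) -> F y x = conjc (F x y).
Proof.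
move=> sF F0; have r z : complex.Im (F z z) = 0 by exact: ger0_Im.
have := r (x + 1 *: y); rewrite sesqui_formDZ// normc1 expr1n.
have := r (x + 'i *: y); rewrite sesqui_formDZ//.
have := r x; have := r y; rewrite sqr_normcE/= !(expr0n,expr1n)/= add0r.
case: (F x x) (F x y) (F y x) (F y y) => [a a'] [b b'] [c c'] [d d']/=.
move=> -> ->; rewrite !(mulr0,mul0r,mul1r,addr0,add0r,subr0,oppr0,mulN1r,mulr1) => h1 h2.
by congr (_ +i* _); lra.
Qed.

(** Nonnegativity at [x - u y], with [u] turning the cross terms into [-2 |F x y|]. This additive
    Cauchy-Schwarz bound needs no division, so null vectors of [F] cause no trouble. *)
Lemma sesqui_form_normc_le F x y : sesqui_form F ->
  (forall z, 0 <= F z z) -> 2 * normc (F x y) <= diag F x + diag F y.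
Proof.
move=> sF F0; have d0 z : 0 <= diag F z.
  by have := F0 z; rewrite lecE => /andP[].
have [u u1 uE] := unimodular_mul (F y x).
have := d0 (x + (- u) *: y); rewrite /diag sesqui_formDZ// normcN u1 expr1n mul1r.
rewrite (sesqui_form_hermitian x y sF F0) in uE *.
rewrite rmorphN/= !mulNr -opprD.
have -> : conjc u * F x y = conjc (u * conjc (F x y)) by rewrite rmorphM/= conjcK.
rewrite uE normc_conj; case: (F x x) (F y y) => [a ?] [b ?] /=; lra.
Qed.

End SesquilinearForm.

(** * Decreasing the modulus of one form where another is nearly null *)

Section DiagonalDescent.
Context (R : realType) (V : lmodType R[i]).
(** Later [E] is the semi-inner product, [P x y] is [|T|^2 E x y - E (T x) (T y)] and [B x y] is
    [E (S x) (T y)]. *)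
Variables E P B : V -> V -> R[i].
Hypotheses (sE : sesqui_form E) (sP : sesqui_form P) (sB : sesqui_form B).
Hypotheses (E_ge0 : forall x, 0 <= E x x) (P_ge0 : forall x, 0 <= diag P x).
Variable M : R.
Hypothesis B_le : forall x y, diag E x = 1 -> diag E y = 1 -> normc (B x y) <= M.

Let diagE_ge0 x : 0 <= diag E x.
Proof. by have := E_ge0 x; rewrite lecE => /andP[]. Qed.

Let diagE_real x : E x x = (diag E x)%:C.
Proof. by rewrite /diag; have := ger0_Im (E_ge0 x); case: (E x x) => a b /= ->. Qed.

Let E_le1 x y : diag E x = 1 -> diag E y = 1 -> normc (E x y) <= 1.
Proof. by move=> x1 y1; have := sesqui_form_normc_le x y sE E_ge0; lra. Qed.

(** The cross term [-2 p a X] pays for everything. Half of it covers [X^2], as [X <= p/4 <= p a].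
    The other half is at least [p a s^2 d]: one half of that covers the term in [b], as [a >= 1/4],
    and the rest is at least [a^2 p s^2 d / 8], as [a <= 4]. *)
Lemma sqr_modulus_perturbation (a p X b s d : R) :
  4^-1 <= a <= 4 -> 0 < p -> s ^+ 2 * d <= X -> 4 * X <= p -> 0 < d ->
  8 * s ^+ 2 * b ^+ 2 <= p * d ->
  (p * a - X) ^+ 2 + (s ^+ 2 * b) ^+ 2 <= a ^+ 2 * (p ^+ 2 - p * s ^+ 2 * d / 8).
Proof.
move=> /andP[a1 a4] p0 sX Xp d0 bp.
have s0 := sqr_ge0 s.
have X0 : 0 <= X by apply: le_trans sX; rewrite mulr_ge0// ltW.
have h1 : X * X <= p * a * X by apply: ler_wpM2r => //; nra.
have h2 : (s ^+ 2 * b) ^+ 2 <= s ^+ 2 * (p * d) / 8.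
  rewrite (_ : _ ^+ 2 = s ^+ 2 * (8 * s ^+ 2 * b ^+ 2) / 8); last by field.
  by rewrite ler_pM2r ?invr_gt0// ler_wpM2l.
have h3 : p * a * (s ^+ 2 * d) <= p * a * X by apply: ler_wpM2l => //; nra.
have sd0 : 0 <= p * (s ^+ 2 * d) by rewrite (mulr_ge0 (ltW p0))// (mulr_ge0 s0)// ltW.
have h4 : 4^-1 * (p * (s ^+ 2 * d)) <= a * (p * (s ^+ 2 * d)) by rewrite ler_wpM2r.
have h5 : a ^+ 2 * (p * (s ^+ 2 * d)) <= 4 * a * (p * (s ^+ 2 * d)).
  by apply: ler_wpM2r => //; nra.
by lra.
Qed.

Lemma exists_normalized z : 0 < diag E z -> exists z',
  [/\ diag E z' = 1, diag P z' = diag P z / diag E z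
    & normc (B z' z') = normc (B z z) / diag E z].
Proof.
move=> z0; pose r := (Num.sqrt (diag E z))^-1.
have r2 : normc r%:C ^+ 2 = (diag E z)^-1.
  by rewrite normc_real ger0_norm ?invr_ge0 ?sqrtr_ge0// exprVn sqr_sqrtr// ltW.
exists (r%:C *: z); split.
- by rewrite diagZ// r2 mulVf// gt_eqF.
- by rewrite diagZ// r2 mulrC.
rewrite sesqui_formZ// normcM normc_real r2 ger0_norm ?invr_ge0 ?(ltW z0)//.
exact: mulrC.
Qed.

(* Moving from [x] in the direction [s * th] of [y], the first-order change of
   [u * B z z - |B x x| * E z z] is made real and nonpositive by the choice of
   the phase [th], so that the second-order term, which is negative by the
   assumption on [y], decides. *)
Lemma diag_descent (x y : V) (u : R[i]) (eta s delta : R) :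
  diag E x = 1 -> diag E y = 1 -> diag P x <= delta -> diag P y <= delta ->
  normc u = 1 -> u * B x x = (normc (B x x))%:C ->
  0 < eta -> eta <= normc (B x x) ->
  complex.Re (u * B y y) <= normc (B x x) - eta ->
  0 < s -> 20 * M * s <= eta ->
  exists z, [/\ diag E z = 1, diag P z <= 16 * delta
    & normc (B z z) ^+ 2 <= normc (B x x) ^+ 2 - s ^+ 2 * eta ^+ 2 / 8].
Proof.
move=> x1 y1 xd yd u1 uE eta0 etap uy s0 Ms.
set p := normc (B x x) in uE etap uy *.
have p0 : 0 < p by exact: lt_le_trans etap.
have pM : p <= M by exact: B_le.
have M0 : 0 < M by exact: lt_le_trans pM.
have s20 : 20 * s <= 1.
  by rewrite -(ler_pM2l M0) mulr1 mulrA [M * 20]mulrC; lra.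
have s2 : s ^+ 2 <= 4^-1 by rewrite expr2; nra.
have [th [k [th1 k0 thE]]] :=
  unimodular_combination_le0 (u * B x y - p%:C * E x y) (u * B y x - p%:C * E y x).
(* Each off-diagonal value of [u B - p E] is at most [2 M], because [p <= M] and [|E| <= 1] on unit
   vectors. *)
have k4 : k <= 4 * M.
  have : normc (- k)%:C <= 4 * M; last by rewrite normc_real normrN ger0_norm.
  rewrite -thE (le_trans (le_normcD _ _))// !normcM normc_conj th1 !mul1r.
  have bnd a b : diag E a = 1 -> diag E b = 1 ->
      normc (u * B a b - p%:C * E a b) <= 2 * M.
    move=> a1 b1; rewrite (le_trans (le_normcD _ _))// normcN !normcM u1 mul1r.
    rewrite normc_real gtr0_norm//.
    by have := B_le a1 b1; have := E_le1 a1 b1; have := normc_ge0 (E a b); nra.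
  by have := bnd _ _ x1 y1; have := bnd _ _ y1 x1; lra.
pose c := s%:C * th; pose w := x + c *: y.
have nc : normc c = s by rewrite normcM th1 mulr1 normc_real gtr0_norm.
have cE : conjc c = s%:C * conjc th by rewrite rmorphM; congr (_ * _); exact: conjc_real.
(* With [s^2 <= 1/4], the parallelogram bounds give [diag E w <= 2 + 2 s^2] and
   [1 <= 2 diag E w + 2 s^2]. The lower bound [1/4] also turns [4 delta] into [16 delta] upon
   normalization. *)
have a4 : diag E w <= 4.
  have := diagD_le x (c *: y) sE diagE_ge0.
  by rewrite (diagZ _ _ sE) nc x1 y1 -/w; lra.
have a1 : 4^-1 <= diag E w.
  have := diag_le_addr x (c *: y) sE diagE_ge0.
  by rewrite (diagZ _ _ sE) nc x1 y1 -/w; lra.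
have Pw : diag P w <= 4 * delta.
  have := diagD_le x (c *: y) sP P_ge0.
  by rewrite (diagZ _ _ sP) nc -/w; have := P_ge0 y; nra.
pose v := u * B y y.
(* The form [u B - p E] vanishes at [x], so at [w] only the first-order term [- s k] and the
   second-order term [s^2 (v - p)] remain. *)
have wE : u * B w w = p%:C * (diag E w)%:C + s%:C * (- k)%:C
    + (s ^+ 2)%:C * (v - p%:C).
  rewrite -diagE_real -thE /v /w (sesqui_formDZ c x y sB) (sesqui_formDZ c x y sE).
  rewrite nc (diagE_real x) x1.
  by rewrite (diagE_real y) y1 cE /c !mulrDr uE rmorph1; ring.
pose X := s * k + s ^+ 2 * (p - complex.Re v).
have nw : normc (B w w) ^+ 2 =
    (p * diag E w - X) ^+ 2 + (s ^+ 2 * complex.Im v) ^+ 2.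
  rewrite -[normc (B w w)]mul1r -u1 -normcM wE sqr_normcE /X.
  by case: (v) => v1 v2 /=; ring.
have vM : normc v <= M by rewrite normcM u1 mul1r; exact: B_le.
have rv : - M <= complex.Re v.
  by have := le_trans (normr_Re_le v) vM; rewrite ler_norml => /andP[].
have iv : complex.Im v ^+ 2 <= M ^+ 2.
  by rewrite -(real_normK (num_real _)) ler_sqr ?nnegrE// ?(ltW M0)// (le_trans (normr_Im_le _)).
have etad : eta * eta <= p * (p - complex.Re v).
  by apply: ler_pM => //; [exact: ltW|exact: ltW|move: uy; rewrite -/v; lra].
have key : normc (B w w) ^+ 2 <=
    diag E w ^+ 2 * (p ^+ 2 - p * s ^+ 2 * (p - complex.Re v) / 8).
  rewrite nw; apply: sqr_modulus_perturbation; rewrite ?a1//.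
  - by rewrite /X lerDr mulr_ge0// ltW.
  (* The factor 20 is chosen for this: [X <= (9/2) M s <= eta/4 <= p/4]. *)
  - have h1 : s * k <= s * (4 * M) by rewrite ler_wpM2l// ltW.
    have h2 : s ^+ 2 * (p - complex.Re v) <= s * (2^-1 * M).
      rewrite expr2 -mulrA ler_wpM2l ?(ltW s0)//; nra.
    by rewrite /X; nra.
  - by move: uy; rewrite -/v; lra.
  - have h1 : 8 * s ^+ 2 * complex.Im v ^+ 2 <= 8 * (M * s) ^+ 2.
      by rewrite exprMn -mulrA ler_wpM2l// mulrC ler_wpM2r// sqr_ge0.
    have h2 : (20 * M * s) ^+ 2 <= eta ^+ 2.
      by rewrite ler_sqr ?nnegrE ?(ltW eta0)// !mulr_ge0// ltW.
    have h4 := sqr_ge0 (M * s).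
    move: h2; rewrite -mulrA exprMn (expr2 eta); lra.
have w0 : 0 < diag E w by lra.
have [z [z1 zP zB]] := exists_normalized w0.
exists z; split => //.
  by rewrite zP ler_pdivrMr//; have := P_ge0 w; nra.
rewrite zB expr_div_n ler_pdivrMr ?exprn_gt0// [leRHS]mulrC.
apply: le_trans key _; apply: ler_wpM2l; first exact: sqr_ge0.
have h2 : s ^+ 2 * (eta * eta) <= s ^+ 2 * (p * (p - complex.Re v)).
  by apply: ler_wpM2l => //; exact: sqr_ge0.
by rewrite (expr2 eta); lra.
Qed.

(** [W] collects the bounds on [|B x x|^2] that can be met with [diag P x] arbitrarily small. Above
    [(r + delta)^2], [diag_descent] lowers any such bound by a fixed [c], independent of the
    tolerance on [P]; so the infimum of [W] lies below that level. *)
Lemma exists_small_diag (r delta : R) : 0 <= r ->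
  (forall u : R[i], normc u = 1 -> forall e, 0 < e -> exists y,
    [/\ diag E y = 1, diag P y <= e & complex.Re (u * B y y) <= r + e]) ->
  0 < delta ->
  exists x, [/\ diag E x = 1, diag P x <= delta & normc (B x x) <= r + delta].
Proof.
move=> r0 dir d0.
pose W : set R := [set v | forall e, 0 < e -> exists x,
  [/\ diag E x = 1, diag P x <= e & normc (B x x) ^+ 2 <= v]].
suff /(_ _ d0)[x [x1 xP xB]] : W ((r + delta) ^+ 2).
  by exists x; split => //; rewrite -ler_sqr ?nnegrE ?normc_ge0//; lra.
have W0 v : W v -> 0 <= v.
  by move=> /(_ 1 ltr01)[x [_ _]]; apply: le_trans; exact: sqr_ge0.
have M0 : 0 <= M.
  have [x [x1 _ _]] := dir 1 (normc1 R) 1 ltr01.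
  exact: le_trans (normc_ge0 _) (B_le x1 x1).
have WM : W (M ^+ 2).
  move=> e e0; have [x [x1 xP _]] := dir 1 (normc1 R) e e0; exists x; split => //.
  by rewrite ler_sqr ?nnegrE ?normc_ge0//; exact: B_le.
have infW : has_inf W by split; [exists (M ^+ 2)|exists 0 => v /W0].
(* The denominator ensures both [20 M s <= eta] and [s <= 1]. *)
pose eta := delta / 4; pose s := eta / (20 * (M + 1) + delta).
have eta0 : 0 < eta by rewrite divr_gt0.
have D0 : 0 < 20 * (M + 1) + delta by lra.
have s0 : 0 < s by rewrite divr_gt0.
have sD : s * (20 * (M + 1) + delta) = eta by rewrite mulfVK// gt_eqF.
have Ms : 20 * M * s <= eta by nra.
have s1 : s <= 1 by rewrite ler_pdivrMr//; rewrite /eta; lra.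
pose c := s ^+ 2 * eta ^+ 2 / 8.
have c0 : 0 < c by rewrite divr_gt0// mulr_gt0// exprn_gt0.
have cd : c <= delta ^+ 2 / 128.
  have : s ^+ 2 * eta ^+ 2 <= eta ^+ 2.
    by rewrite ler_piMl ?sqr_ge0// expr_le1// ltW.
  by rewrite /c /eta; lra.
have descent v : (r + delta) ^+ 2 <= v -> W v -> W (v - c).
  (* [e / 16] compensates the loss in [diag_descent]; [eta] leaves the gap, since
     [r + e' <= r + delta/2 - eta]. *)
  move=> rv Wv e e0; pose e' := Num.min (e / 16) eta.
  have e'0 : 0 < e' by rewrite lt_min eta0 divr_gt0.
  have e'e : e' <= e / 16 by rewrite ge_min lexx.
  have e'eta : e' <= eta by rewrite ge_min lexx orbT.
  have [x [x1 xP xB]] := Wv e' e'0.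
  (* Either [x] itself meets the lowered bound, or [|B x x|^2] exceeds
     [(r + delta)^2 - delta^2/128], which forces [|B x x| >= r + delta/2]. *)
  have [xc|xc] := leP (normc (B x x) ^+ 2) (v - c).
    by exists x; split => //; lra.
  have px : r + delta / 2 <= normc (B x x).
    by rewrite -ler_sqr ?nnegrE ?normc_ge0//; nra.
  have [u u1 uE] := unimodular_mul (B x x).
  have [y [y1 yP yB]] := dir u u1 e' e'0.
  have [||z [z1 zP zB]] := diag_descent x1 y1 xP yP u1 uE eta0 _ _ s0 Ms.
  - by rewrite /eta; lra.
  - by rewrite /eta in e'eta *; lra.
  by exists z; split => //; rewrite /c; lra.
have [h|h] := leP ((r + delta) ^+ 2) (inf W).
  have [v Wv vm] := inf_adherent c0 infW.
  have /(ge_inf infW.2) : W (v - c) by apply: descent => //; exact: le_trans h (ge_inf infW.2 Wv).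
  by lra.
have [v Wv vm] : exists2 v, W v & v < (r + delta) ^+ 2.
  have e0 : 0 < (r + delta) ^+ 2 - inf W by rewrite subr_gt0.
  by have [v Wv vm] := inf_adherent e0 infW; exists v => //; lra.
by move=> e /Wv[x [x1 xP xB]]; exists x; split => //; lra.
Qed.

End DiagonalDescent.

(** * Convergence and compactness for complex sequences *)

Section ComplexSequences.
Context (R : realType).
Implicit Types (w : nat -> R[i]) (l : R[i]).

Lemma cvg_complexP w l :
  ((w n : R[i]^o) @[n --> \oo] --> (l : R[i]^o)) <->
  (complex.Re (w n) @[n --> \oo] --> complex.Re l /\
   complex.Im (w n) @[n --> \oo] --> complex.Im l).
Proof.
have nE (z : R[i]^o) : `|z| = (normc (z : R[i]))%:C by [].
split=> [/cvgrPdist_lt wl|[/cvgrPdist_lt rl /cvgrPdist_lt il]].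
  split; apply/cvgrPdist_lt => e e0; have e0' : 0 < e%:C by rewrite ltcR.
    near=> n; have : `|(l : R[i]^o) - w n| < e%:C by near: n; exact: wl.
    rewrite nE ltcR; apply: le_lt_trans; apply: le_trans (normr_Re_le _).
    by case: (l) (w n) => [? ?] [? ?].
  near=> n; have : `|(l : R[i]^o) - w n| < e%:C by near: n; exact: wl.
  rewrite nE ltcR; apply: le_lt_trans; apply: le_trans (normr_Im_le _).
  by case: (l) (w n) => [? ?] [? ?].
apply/cvgrPdist_lt => e e0.
(* The tolerance [e] is a positive element of [R[i]], hence real. *)
have eE : e = (complex.Re e)%:C by rewrite RRe_real// gtr0_real.
have e2 : 0 < complex.Re e / 2 by rewrite divr_gt0// -ltcR -eE.
near=> n; rewrite eE nE ltcR; apply: le_lt_trans (normc_le_ReIm _) _.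
have h1 : `|complex.Re l - complex.Re (w n)| < complex.Re e / 2 by near: n; exact: rl.
have h2 : `|complex.Im l - complex.Im (w n)| < complex.Re e / 2 by near: n; exact: il.
by case: (l) (w n) h1 h2 => [? ?] [? ?] /=; lra.
Unshelve. all: by end_near. Qed.

Lemma increasing_seq_cvgny (f : nat -> nat) : increasing_seq f ->
  f n @[n --> \oo] --> \oo.
Proof.
move=> /increasing_seqP fS; apply/cvgnyPge => k; near=> n.
apply: (@leq_trans n); first by near: n; exact: nbhs_infty_ge.
by elim: (n) => // m /leq_ltn_trans; apply; exact: fS.
Unshelve. all: by end_near. Qed.

(** Two successive extractions: one for the real parts, then one for the imaginary parts along the
    first. *)
Lemma complex_bolzano_weierstrass w (K : R) : (forall n, normc (w n) <= K) ->
  exists f l, f n @[n --> \oo] --> \oo /\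
    ((w (f n) : R[i]^o) @[n --> \oo] --> (l : R[i]^o)).
Proof.
move=> wK.
have bnd (u : nat -> R) : (forall n, `|u n| <= K) -> bounded_fun u.
  move=> uK; exists K; split; first exact: num_real.
  by move=> x Kx n _; exact: le_trans (uK n) (ltW Kx).
have [f fi /cvg_ex[a fa]] := bolzano_weierstrass
  (bnd (fun n => complex.Re (w n)) (fun n => le_trans (normr_Re_le _) (wK n))).
have [g gi /cvg_ex[b gb]] := bolzano_weierstrass
  (bnd (fun n => complex.Im (w (f n))) (fun n => le_trans (normr_Im_le _) (wK _))).
have goo := increasing_seq_cvgny gi.
exists (f \o g), (a +i* b); split.
  exact: cvg_comp goo (increasing_seq_cvgny fi).
by apply/cvg_complexP; split => //=; exact: cvg_comp goo fa.
Qed.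

End ComplexSequences.

(** * The seminorm of [A] and the induced operator seminorm *)

Section SemiHilbertOperators.
Context (R : realType) (H : completeNormedModType R[i]).
Context (ip : {dot H for Num.conj}) (A : {linear H -> H}).
Hypothesis A_positive : positive_op ip A.
Local Notation E := (ipA ip A).
Local Notation normA := (normA ip A).
Local Notation opnormA := (opnormA ip A).

Lemma ipA_sesqui_form : sesqui_form E.
Proof.
rewrite /ipA; split=> [x y z|x y z|c x y|c x y].
- by rewrite linearD linearDl.
- by rewrite linearDr.
- by rewrite linearZ linearZl_LR.
- by rewrite linearZr_LR.
Qed.

Let sE := ipA_sesqui_form.

Lemma ipA_diag_ge0 x : 0 <= diag E x.
Proof. by have := A_positive x; rewrite lecE => /andP[]. Qed.

Lemma normA_ge0 x : 0 <= normA x.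
Proof. exact: sqrtr_ge0. Qed.

Lemma sqr_normA x : normA x ^+ 2 = diag E x.
Proof. by rewrite sqr_sqrtr//; exact: ipA_diag_ge0. Qed.

Lemma normA_eq1 x : normA x = 1 <-> diag E x = 1.
Proof.
split=> [x1|x1]; first by rewrite -sqr_normA x1 expr1n.
by rewrite -[LHS]/(Num.sqrt (diag E x)) x1 sqrtr1.
Qed.

Lemma normAZ c x : normA (c *: x) = normc c * normA x.
Proof.
rewrite -[LHS]/(Num.sqrt (diag E (c *: x))) diagZ// sqrtrM ?sqr_ge0//.
by rewrite sqrtr_sqr ger0_norm ?normc_ge0.
Qed.

(** If [E] vanished on the diagonal, Cauchy-Schwarz would give [E x (A x) = 0]; this number is
    [|A x|^2], so [A] would be zero. *)
Lemma sphereA_neq0 : norm_ip ip -> A <> \0 :> (H -> H) -> exists x, normA x = 1.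
Proof.
move=> ip_norm A0; have [x x0] : exists x, 0 < diag E x.
  apply: contrapT => /forallNP E0; apply: A0; apply/funext => x.
  have E00 y : diag E y = 0.
    by apply/eqP; rewrite eq_le ipA_diag_ge0 andbT leNgt; apply/negP/E0.
  have := sesqui_form_normc_le x (A x) sE A_positive; rewrite !E00 addr0.
  have := normc_ge0 (E x (A x)) => h1 h2.
  have /eq0_normc : normc (E x (A x)) = 0 by lra.
  by rewrite /ipA -ip_norm => /eqP; rewrite expf_eq0/= normr_eq0 => /eqP.
by have [y [/normA_eq1 y1 _ _]] := exists_normalized sE sE sE A_positive x0; exists y.
Qed.

Hypothesis sphereA_nonempty : exists x, normA x = 1.

Lemma opnormA_le (U : H -> H) k : (forall x, normA x = 1 -> normA (U x) <= k) ->
  opnormA U <= k.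
Proof.
move=> Uk; apply: ge_sup.
  by have [x x1] := sphereA_nonempty; exists (normA (U x)), x.
by move=> _ [x x1 <-]; exact: Uk.
Qed.

Lemma normA_le_opnormA_sphere (U : H -> H) k x :
  (forall x, normA x = 1 -> normA (U x) <= k) -> normA x = 1 ->
  normA (U x) <= opnormA U.
Proof.
move=> Uk x1; apply: ub_le_sup; last by exists x.
by exists k => _ [y y1 <-]; exact: Uk.
Qed.

Lemma opnormA_ge0 (U : H -> H) : 0 <= opnormA U.
Proof.
have [[[_ [x x1 _]] ub]|ns] :=
    pselect (has_sup [set normA (U x) | x in sphereA ip A]).
  by apply: le_trans (normA_ge0 _) (ub_le_sup ub _); exists x.
(* Without a finite supremum, [sup] takes the default value 0. *)
by rewrite /Defs.opnormA sup_out.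
Qed.

Lemma sqr_opnormA_approx (U : H -> H) e : 0 < e ->
  exists2 x, normA x = 1 & opnormA U ^+ 2 - e < diag E (U x).
Proof.
move=> e0; apply: contrapT => /forall2NP nx.
have Ue x : normA x = 1 -> diag E (U x) <= opnormA U ^+ 2 - e.
  by move=> x1; rewrite leNgt; apply/negP; case: (nx x).
(* A unit vector shows that [|U|^2 - e] is nonnegative, so its square root is a genuine one and
   bounds [U] on the sphere. *)
have [x0 x01] := sphereA_nonempty.
have k0 := le_trans (ipA_diag_ge0 _) (Ue x0 x01).
have : opnormA U <= Num.sqrt (opnormA U ^+ 2 - e).
  by apply: opnormA_le => x x1; apply: ler_wsqrtr; exact: Ue.
rewrite -ler_sqr ?nnegrE ?sqrtr_ge0 ?opnormA_ge0// sqr_sqrtr//; lra.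
Qed.

Lemma bounded_opA_sphere (U : H -> H) : bounded_opA ip A U ->
  exists k, forall x, normA x = 1 -> normA (U x) <= k.
Proof.
by move=> [_ [c _ Uc]]; exists c => x x1; rewrite (le_trans (Uc x))// x1 mulr1.
Qed.

Lemma normA_le_opnormA (U : {linear H -> H}) x : bounded_opA ip A U ->
  normA (U x) <= opnormA U * normA x.
Proof.
move=> bU; have [k Uk] := bounded_opA_sphere bU; have [_ [c c0 Uc]] := bU.
(* A vector of seminorm 0 cannot be normalized; the constant [c] of [A]-boundedness shows that [U]
   maps it to seminorm 0. *)
have [x0|x0] := eqVneq (normA x) 0.
  by rewrite x0 mulr0; have := Uc x; rewrite x0 mulr0.
have nx : normc (normA x)^-1%:C = (normA x)^-1.
  by rewrite normc_real ger0_norm// invr_ge0 normA_ge0.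
have x1 : normA ((normA x)^-1%:C *: x) = 1 by rewrite normAZ nx mulVf.
have := normA_le_opnormA_sphere Uk x1; rewrite linearZ normAZ nx.
by rewrite mulrC ler_pdivrMr// lt_neqAle eq_sym x0 normA_ge0.
Qed.

Lemma diag_le_opnormA (U : {linear H -> H}) x : bounded_opA ip A U ->
  diag E (U x) <= opnormA U ^+ 2 * diag E x.
Proof.
move=> bU; rewrite -!sqr_normA -exprMn ler_sqr ?nnegrE ?mulr_ge0 ?normA_ge0//.
  exact: normA_le_opnormA.
exact: opnormA_ge0.
Qed.

Lemma opnormAZ c (U : {linear H -> H}) : bounded_opA ip A U ->
  opnormA (c \*: U) = normc c * opnormA U.
Proof.
move=> bU; have cU x : normA x = 1 -> normA ((c \*: U) x) <= normc c * opnormA U.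
  move=> x1; rewrite normAZ ler_wpM2l ?normc_ge0//.
  by rewrite (le_trans (normA_le_opnormA _ bU))// x1 mulr1.
apply/eqP; rewrite eq_le opnormA_le//=.
have [c0|c0] := eqVneq (normc c) 0; first by rewrite c0 mul0r opnormA_ge0.
have c_gt0 : 0 < normc c by rewrite lt_neqAle eq_sym c0 normc_ge0.
rewrite mulrC -ler_pdivlMr//; apply: opnormA_le => x x1.
by rewrite ler_pdivlMr// mulrC -normAZ; exact: normA_le_opnormA_sphere cU x1.
Qed.

Lemma diag_ipA_DZ c x y :
  diag E (x + c *: y) = diag E x + 2 * complex.Re (c * E y x) + normc c ^+ 2 * diag E y.
Proof.
rewrite /diag sesqui_formDZ// (sesqui_form_hermitian y x sE A_positive).
by case: (E x x) (E y x) (E y y) c => [? ?] [? ?] [? ?] [? ?] /=; ring.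
Qed.

(** * The two implications for a pair of [A]-bounded operators *)

Variables T S : {linear H -> H}.
Hypotheses (bT : bounded_opA ip A T) (bS : bounded_opA ip A S).

(** The explicit bound [Uk] serves only to show that the supremum defining the seminorm of [T + c S]
    is finite. *)
Lemma diag_le_opnormA_perturbation c x : normA x = 1 ->
  diag E (T x + c *: S x) <= opnormA (T \+ c \*: S) ^+ 2.
Proof.
have Uk y : normA y = 1 -> normA ((T \+ c \*: S) y) <=
    Num.sqrt (2 * opnormA T ^+ 2 + 2 * (normc c ^+ 2 * opnormA S ^+ 2)).
  move=> /normA_eq1 y1; apply: ler_wsqrtr.
  apply: le_trans (diagD_le _ _ sE ipA_diag_ge0) _.
  rewrite diagZ//; have := diag_le_opnormA y bT; have := diag_le_opnormA y bS.
  rewrite y1 !mulr1 => h1 h2; have := ler_wpM2l (sqr_ge0 (normc c)) h1; lra.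
move=> /(normA_le_opnormA_sphere Uk).
by rewrite -ler_sqr ?nnegrE ?normA_ge0 ?opnormA_ge0// sqr_normA.
Qed.

Lemma ipA_ops_sesqui_form (U W : {linear H -> H}) :
  sesqui_form (fun x y => E (U x) (W y)).
Proof.
by have [Dl Dr Zl Zr] := sE; split=> *; rewrite ?linearD ?linearZ ?(Dl, Dr, Zl, Zr).
Qed.

Lemma ipA_ops_le x y : diag E x = 1 -> diag E y = 1 ->
  normc (E (S x) (T y)) <= (opnormA S ^+ 2 + opnormA T ^+ 2) / 2.
Proof.
move=> x1 y1; have := sesqui_form_normc_le (S x) (T y) sE A_positive.
have := diag_le_opnormA x bS; have := diag_le_opnormA y bT; rewrite x1 y1; lra.
Qed.

Lemma approx_orthoA_of_maxrangeA eps :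
  maxrangeA ip A T S `&` cdisc (eps * opnormA T * opnormA S) !=set0 ->
  approx_orthoA ip A eps T S.
Proof.
move=> [l [[x_ [x1 Tx Sx]] lr]] c; rewrite opnormAZ//.
have {}lr : normc l <= eps * opnormA T * opnormA S by rewrite -lecR.
have [Rf If] := (cvg_complexP _ _).1 Sx.
have lim : (normA (T (x_ n)) ^+ 2 + 2 * (complex.Re c * complex.Re (E (S (x_ n)) (T (x_ n)))
    - complex.Im c * complex.Im (E (S (x_ n)) (T (x_ n))))) @[n --> \oo] -->
    opnormA T ^+ 2 + 2 * (complex.Re c * complex.Re l - complex.Im c * complex.Im l).
  apply: cvgD; first by rewrite expr2; under eq_fun do rewrite expr2; exact: cvgM.
  by apply: cvgM; [exact: cvg_cst|apply: cvgB; apply: cvgM => //; exact: cvg_cst].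
(* The nonnegative term [|c|^2 |S x_n|^2] is dropped before taking the limit. *)
have : opnormA T ^+ 2 + 2 * (complex.Re c * complex.Re l - complex.Im c * complex.Im l)
    <= opnormA (T \+ c \*: S) ^+ 2.
  apply: (cvgr_to_le lim); apply: nearW => n.
  have := diag_le_opnormA_perturbation c (x1 n); apply: le_trans.
  rewrite diag_ipA_DZ sqr_normA.
  have : 0 <= normc c ^+ 2 * diag E (S (x_ n)) by rewrite mulr_ge0 ?sqr_ge0 ?ipA_diag_ge0.
  by case: (c) (E (S (x_ n)) (T (x_ n))) => [? ?] [? ?] /=; lra.
apply: le_trans; rewrite lerD2l.
have : - (normc c * normc l) <= complex.Re c * complex.Re l - complex.Im c * complex.Im l.
  have := normr_Re_le (c * l); rewrite normcM ler_norml => /andP[+ _].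
  by case: (c) (l) => [? ?] [? ?].
have := ler_wpM2l (normc_ge0 c) lr; lra.
Qed.

(** A near-maximizer [x] for [T - t u S] satisfies [|T|^2 - |T x|^2 < 2 t (r - f) + t^2 (1 +
    |S|^2)]. Since [f >= - M], the right side is at most [t D <= e]; since the left side is
    nonnegative, dividing by [t] bounds [f - r]. *)
Lemma approx_orthoA_direction eps u e : 0 <= eps -> approx_orthoA ip A eps T S ->
  normc u = 1 -> 0 < e -> exists x,
  [/\ diag E x = 1, opnormA T ^+ 2 - diag E (T x) <= e
    & complex.Re (u * E (S x) (T x)) <= eps * opnormA T * opnormA S + e].
Proof.
move=> eps0 orth u1 e0.
pose r := eps * opnormA T * opnormA S.
pose M := (opnormA S ^+ 2 + opnormA T ^+ 2) / 2.
pose D := 2 * (r + M) + 1 + opnormA S ^+ 2.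
have r0 : 0 <= r by rewrite /r !mulr_ge0 ?opnormA_ge0.
have S0 : 0 <= opnormA S ^+ 2 := sqr_ge0 _.
have M0 : 0 <= M by rewrite divr_ge0 ?addr_ge0 ?sqr_ge0.
have D0 : 0 < D by rewrite /D; lra.
pose t := Num.min 1 (e / D).
have t0 : 0 < t by rewrite lt_min ltr01 divr_gt0.
have t1 : t <= 1 by rewrite ge_min lexx.
have tD : t * D <= e by rewrite -ler_pdivlMr// ge_min lexx orbT.
(* The tolerance [t^2] is of second order, so it stays small after division by [t]. *)
have [x x1 xU] := sqr_opnormA_approx (T \+ (- (t%:C * u)) \*: S) (exprn_gt0 2 t0).
have := orth (- (t%:C * u)); rewrite opnormAZ// normcN normcM u1 mulr1.
rewrite normc_real gtr0_norm// => orthx.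
have {x1}x1 := (normA_eq1 x).1 x1.
have := diag_le_opnormA x bT; have := diag_le_opnormA x bS; rewrite x1 !mulr1 => Sx Tx.
have uM : normc (u * E (S x) (T x)) <= M by rewrite normcM u1 mul1r; exact: ipA_ops_le.
set f := complex.Re (u * E (S x) (T x)).
have fM : - M <= f.
  by have := le_trans (normr_Re_le _) uM; rewrite ler_norml => /andP[].
have fE : complex.Re (- (t%:C * u) * E (S x) (T x)) = - (t * f).
  by rewrite /f; case: (u) (E (S x) (T x)) => [? ?] [? ?] /=; ring.
have nE : normc (- (t%:C * u)) = t by rewrite normcN normcM u1 mulr1 normc_real gtr0_norm.
have {}xU : opnormA T ^+ 2 - diag E (T x) < 2 * t * (r - f) + t ^+ 2 * (1 + opnormA S ^+ 2).
  have : diag E ((T \+ (- (t%:C * u)) \*: S) x) =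
      diag E (T x) - 2 * t * f + t ^+ 2 * diag E (S x).
    by rewrite -[(_ \+ _) x]/(T x + (- (t%:C * u)) *: S x) diag_ipA_DZ fE nE; ring.
  have := ler_wpM2l (sqr_ge0 t) Sx; move: xU orthx; rewrite /r; lra.
have tt : t ^+ 2 * (1 + opnormA S ^+ 2) <= t * (1 + opnormA S ^+ 2).
  by rewrite expr2 ler_wpM2r ?addr_ge0// ler_piMr// ltW.
exists x; split => //.
  have : t * (r - f) <= t * (r + M) by rewrite ler_wpM2l ?(ltW t0)//; lra.
  by move: tD; rewrite /D; lra.
have : t * (2 * (f - r)) < t * (t * (1 + opnormA S ^+ 2)) by rewrite mulrA -expr2; lra.
rewrite ltr_pM2l// => h; have : 0 <= t * (r + M) by rewrite mulr_ge0 ?(ltW t0)// addr_ge0.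
have : 0 <= t * (1 + opnormA S ^+ 2) by rewrite mulr_ge0 ?(ltW t0)// addr_ge0.
by move: tD; rewrite /D -/r; lra.
Qed.

Lemma maxrangeA_of_approx_orthoA eps : 0 <= eps -> approx_orthoA ip A eps T S ->
  maxrangeA ip A T S `&` cdisc (eps * opnormA T * opnormA S) !=set0.
Proof.
move=> eps0 orth; pose r := eps * opnormA T * opnormA S.
have r0 : 0 <= r by rewrite /r !mulr_ge0 ?opnormA_ge0.
(* On unit vectors, [diag P] measures how far [|T x|] is from its supremum. *)
pose P x y := (opnormA T ^+ 2)%:C * E x y - E (T x) (T y).
have sP : sesqui_form P.
  have [Dl Dr Zl Zr] := sE; rewrite /P.
  split=> [x y z|x y z|c x y|c x y]; rewrite !(linearD, linearZ) ?(Dl, Dr, Zl, Zr); ring.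
have diagP x : diag P x = opnormA T ^+ 2 * diag E x - diag E (T x).
  by rewrite /diag /P; case: (E x x) (E (T x) (T x)) => [? ?] [? ?] /=; ring.
have P0 x : 0 <= diag P x by rewrite diagP subr_ge0 diag_le_opnormA.
have small e : 0 < e -> exists x, [/\ diag E x = 1,
    opnormA T ^+ 2 - diag E (T x) <= e & normc (E (S x) (T x)) <= r + e].
  move=> e0; have [|x [x1 xP xB]] := exists_small_diag sE sP
    (ipA_ops_sesqui_form S T) A_positive P0 ipA_ops_le r0 _ e0.
    move=> u u1 d d0; have [x [x1 xP xB]] := approx_orthoA_direction eps0 orth u1 d0.
    by exists x; split => //; rewrite diagP x1 mulr1.
  by exists x; split => //; move: xP; rewrite diagP x1 mulr1.
have /choice[x_ x_P] n := small _ (harmonic_gt0 (R := R) n).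
have wK n : normc (E (S (x_ n)) (T (x_ n))) <= (opnormA S ^+ 2 + opnormA T ^+ 2) / 2.
  by have [x1 _ _] := x_P n; exact: ipA_ops_le.
have [f [l [foo wl]]] := complex_bolzano_weierstrass wK.
exists l; split.
  exists (x_ \o f); split => [n||//].
    by have [x1 _ _] := x_P (f n); exact/normA_eq1.
  (* The seminorms converge along the whole sequence, by squeezing; only the pairings need the
     subsequence. *)
  suff Tx : normA (T (x_ n)) @[n --> \oo] --> opnormA T by exact: cvg_comp foo Tx.
  have dT : diag E (T (x_ n)) @[n --> \oo] --> opnormA T ^+ 2.
    apply: (@squeeze_cvgr _ _ _ _ (fun n => opnormA T ^+ 2 - harmonic n)
      (fun=> opnormA T ^+ 2)); last exact: cvg_cst.
      apply: nearW => n; have [x1 xP _] := x_P n; apply/andP; split; first by lra.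
      by have := diag_le_opnormA (x_ n) bT; rewrite x1 mulr1.
    by rewrite -[X in _ --> X]subr0; apply: cvgB; [exact: cvg_cst|exact: cvg_harmonic].
  rewrite -[X in _ --> X]ger0_norm ?opnormA_ge0// -sqrtr_sqr.
  change (Num.sqrt (diag E (T (x_ n))) @[n --> \oo] --> Num.sqrt (opnormA T ^+ 2)).
  by apply: continuous_cvg dT; exact: sqrt_continuous.
suff : normc l ^+ 2 <= r ^+ 2.
  by rewrite ler_sqr ?nnegrE ?normc_ge0// => lr; rewrite /cdisc/= -[`|l|]/(normc l)%:C lecR.
have [Rl Il] := (cvg_complexP _ _).1 wl.
rewrite sqr_normcE.
have lhs : (complex.Re (E (S (x_ (f n))) (T (x_ (f n)))) ^+ 2 +
    complex.Im (E (S (x_ (f n))) (T (x_ (f n)))) ^+ 2) @[n --> \oo] -->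
    complex.Re l ^+ 2 + complex.Im l ^+ 2.
  by rewrite !expr2; under eq_fun do rewrite !expr2; apply: cvgD; exact: cvgM.
have rhs : ((r + harmonic (f n)) * (r + harmonic (f n))) @[n --> \oo] --> r ^+ 2.
  have h : (r + harmonic (f n)) @[n --> \oo] --> r.
    rewrite -[X in _ --> X]addr0; apply: cvgD; first exact: cvg_cst.
    exact: cvg_comp foo (@cvg_harmonic R).
  by rewrite expr2; exact: cvgM.
apply: (ler_cvg_to lhs rhs); apply: nearW => n; rewrite -sqr_normcE -expr2.
have [_ _ xB] := x_P (f n); rewrite ler_sqr ?nnegrE ?normc_ge0//.
by rewrite addr_ge0// ltW// harmonic_gt0.
Qed.

End SemiHilbertOperators.

Theorem theorem2p1 (R : realType) (H : completeNormedModType R[i])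
    (ip : {dot H for Num.conj}) (ip_norm : norm_ip ip)
    (A : {linear H -> H}) (A_bounded : bounded_op A)
    (A_positive : positive_op ip A) (A_neq0 : A <> \0 :> (H -> H))
    (T S : {linear H -> H})
    (hT : bounded_opA ip A T) (hS : bounded_opA ip A S)
    (eps : R) (eps_ge0 : 0 <= eps) (eps_lt1 : eps < 1) :
  approx_orthoA ip A eps T S <->
  maxrangeA ip A T S `&` cdisc (eps * opnormA ip A T * opnormA ip A S) !=set0.
Proof.
(* With a nonempty sphere, the suprema in [opnormA] range over nonempty sets. *)
have sphere := sphereA_neq0 A_positive ip_norm A_neq0.
split; first exact: maxrangeA_of_approx_orthoA.
exact: approx_orthoA_of_maxrangeA.
Qed.
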